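(* Let $n\ge 4$ and $J_n=Jac(Y(n;1,1,1))$. Then (1) if $n$ is odd, $J_n\cong \mathbb{Z}_3^{\,n-4}\oplus\mathbb{Z}_{3n}\oplus\mathbb{Z}_{L_n}^2\oplus\mathbb{Z}_{3L_n}^2$; (2) if $n$ is even, $J_n\cong \mathbb{Z}_3^{\,n-4}\oplus\mathbb{Z}_{3n}\oplus\mathbb{Z}_{F_n}\oplus\mathbb{Z}_{3F_n}\oplus\mathbb{Z}_{5F_n}\oplus\mathbb{Z}_{15F_n}$, where $F_n$ and $L_n$ are the Fibonacci and Lucas numbers.
   Context: $F_0=0,F_1=1,F_{n+1}=F_n+F_{n-1}$; $L_0=2,L_1=1,L_{n+1}=L_n+L_{n-1}$. $\mathbb{Z}_d$ denotes the cyclic group of order $d$. Let $T$ be the $n\times n$ cyclic shift permutation matrix ($T_{i,i+1}=1$, indices mod $n$). The graph $Y(n;1,1,1)$ has vertices $v_{x,y}$, $x\in\{0,1,2,3\}$, $y\in\mathbb{Z}_n$, and edges $v_{i,y}v_{i,y+1}$ and $v_{i,y}v_{0,y}$ for $i=1,2,3$, $y\in\mathbb{Z}_n$. Its Laplacian (degree matrix minus adjacency matrix), with vertices ordered by $x$, is the block matrix $L$ with first block row $(3I_n,-I_n,-I_n,-I_n)$ and, for $i=1,2,3$, block row $i$ having $-I_n$ in block column $0$, $3I_n-T-T^{-1}$ in block column $i$ and zeros elsewhere. The Jacobian group $Jac(G)$ of the graph is the torsion subgroup of $\operatorname{coker}(L)=\mathbb{Z}^{4n}/L\mathbb{Z}^{4n}$.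 *)

(* Defs.v *)
From HB Require Import structures.
From mathcomp Require Import all_boot all_order all_algebra.
From mathcomp Require Import boolp zify.

Set Implicit Arguments.
Unset Strict Implicit.
Unset Printing Implicit Defensive.

Import GRing.Theory.
Local Open Scope ring_scope.

Fixpoint fib (n : nat) : nat :=
  match n with
  | 0 => 0
  | n'.+1 => match n' with 0 => 1 | n''.+1 => fib n' + fib n'' end
  end%N.

Fixpoint lucas (n : nat) : nat :=
  match n with
  | 0 => 2
  | n'.+1 => match n' with 0 => 1 | n''.+1 => lucas n' + lucas n'' end
  end%N.

Definition group_iso (A B : zmodType) : Prop :=
  exists f : {additive A -> B}, bijective f.

Section Torsion.
Variable V : zmodType.

Definition torsion : {pred V} :=
  fun x => `[< exists2 k : nat, (0 < k)%N & x *+ k = 0 >].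

Lemma torsion_zmod_closed : zmod_closed torsion.
Proof.
split; first by apply/asboolP; exists 1%N => //; rewrite mul0rn.
move=> x y /asboolP[k k0 xk] /asboolP[l l0 yl].
apply/asboolP; exists (k * l)%N; first by rewrite muln_gt0 k0.
by rewrite mulrnBl mulrnA xk mul0rn mulnC mulrnA yl mul0rn subr0.
Qed.

HB.instance Definition _ :=
  GRing.isZmodClosed.Build V torsion torsion_zmod_closed.

Record torsion_subgroup := TorsionElt {
  torsion_val :> V;
  torsion_valP : torsion_val \in torsion
}.

HB.instance Definition _ := [isSub for torsion_val].
HB.instance Definition _ := [Choice of torsion_subgroup by <:].
HB.instance Definition _ := [SubChoice_isSubZmodule of torsion_subgroup by <:].

End Torsion.

Section Cokernel.
Variables (m n : nat) (A : 'M[int]_(m, n)).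

Definition mximage : {pred 'cV[int]_m} :=
  fun u => `[< exists v : 'cV[int]_n, u = A *m v >].

Lemma mximage_zmod_closed : zmod_closed mximage.
Proof.
split; first by apply/asboolP; exists 0; rewrite mulmx0.
move=> _ _ /asboolP[u ->] /asboolP[v ->].
by apply/asboolP; exists (u - v); rewrite mulmxBr.
Qed.

HB.instance Definition _ :=
  GRing.isZmodClosed.Build 'cV[int]_m mximage mximage_zmod_closed.

Definition coker : zmodType := Quotient.quot mximage.

End Cokernel.

(* Graphs are simple: [e] is meant to be symmetric and irreflexive. *)
Section Jacobian.
Variables (V : finType) (e : rel V).

Definition adjacency_mx : 'M[int]_#|V| :=
  \matrix_(i, j) (e (enum_val i) (enum_val j))%:R.

Definition degree_mx : 'M[int]_#|V| :=
  diag_mx (\row_i #|[set w | e (enum_val i) w]|%:R).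

Definition laplacian : 'M[int]_#|V| := degree_mx - adjacency_mx.

Definition Jac : zmodType := torsion_subgroup (coker laplacian).

End Jacobian.

(* Adjacency of Y(n;1,1,1): the pair (x, y) stands for v_{x,y}, and
   [ordS y] is y + 1 modulo n.  This is a simple graph only for n >= 3:
   for n <= 2 the graph Y(n;1,1,1) has loops or multiple edges, which a
   relation does not see. *)
Definition Ygraph (n : nat) : rel ('I_4 * 'I_n) := fun v w =>
  [|| [&& v.1 == w.1, v.1 != ord0 & (w.2 == ordS v.2) || (v.2 == ordS w.2)],
      [&& v.2 == w.2, v.1 == ord0 & w.1 != ord0]
    | [&& v.2 == w.2, v.1 != ord0 & w.1 == ord0]].

Lemma Ygraph_sym (n : nat) : symmetric (@Ygraph n).
Proof.
move=> [x y] [z t]; rewrite /Ygraph /= (eq_sym t y) (eq_sym z x) orbC.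
by have [->|] := eqVneq x z; case: (x == _); case: (z == _);
   rewrite //= ?(orbC (t == _)) ?orbF ?andbF ?andbT // orbC.
Qed.

Lemma Ygraph_irr (n : nat) : (1 < n)%N -> irreflexive (@Ygraph n).
Proof.
move=> n1 [x y]; rewrite /Ygraph /= !eqxx orbb.
suff /negPf-> : y != ordS y by case: (x == _).
rewrite -val_eqE /=; have := ltn_ord y; rewrite leq_eqVlt => /orP[/eqP yn|yn].
  by rewrite yn modnn; apply/eqP => y0; move: n1; rewrite -yn y0.
by rewrite modn_small // neq_ltn ltnSn.
Qed.

(* The enumeration of 'I_4 * 'I_n is lexicographic, so the rows and columns of
   the Laplacian are ordered by x first: this is the block matrix with diagonal
   blocks 3I, 3I - T - T^-1 (three times) and off-diagonal blocks -I in the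
   first block row and column. *)
Lemma laplacian_YgraphE (n : nat) (x x' : 'I_4) (y y' : 'I_n) : (2 < n)%N ->
 laplacian (@Ygraph n) (enum_rank (x, y)) (enum_rank (x', y')) =
  if x == x' then
    3 * (y == y')%:R
      - (if x == ord0 then 0 else (y' == ordS y)%:R + (y == ordS y')%:R)
  else if (x == ord0) || (x' == ord0) then - (y == y')%:R else 0.
Proof.
move=> n2.
have Sy (z : 'I_n) : z != ordS z.
  have /= := Ygraph_irr (ltn_trans (isT : 1 < 2)%N n2) (@Ordinal 4 1 isT, z).
  by rewrite /Ygraph /= eqxx orbb !andbF !orbF => /negbT.
have SSy (z : 'I_n) : z != ordS (ordS z).
  rewrite -val_eqE /= -addn1 modnDml addn1; have zn := ltn_ord z.
  move: (nat_of_ord z) zn => k kn; clear z.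
  case: (ltnP k.+2 n) => h; first by rewrite modn_small // neq_ltn ltnW.
  have -> : k.+2 = (k.+2 - n + n)%N by lia.
  rewrite modnDr modn_small; lia.
have deg : #|[set w | Ygraph (x,y) w]| = 3%N.
  have [x0|x0] := eqVneq x ord0.
    suff -> : [set w | Ygraph (x,y) w] = setX [set~ ord0] [set y].
      by rewrite cardsX cards1 muln1 cardsC1 card_ord.
    apply/setP => -[z t]; rewrite !inE /Ygraph /= x0 eqxx /= !andbF /= orbF andbC eq_sym (eq_sym t); by [].
  pose z : 'I_n := ord_pred y.
  have zS : ordS z = y by exact: ord_predK.
  suff -> : [set w | Ygraph (x,y) w] = [set (x, ordS y); (x, z); (ord0, y)].
    rewrite -setUA !cardsU1 cards1 !inE !xpair_eqE (negPf x0) eqxx /=.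
    rewrite -{1}zS; have := SSy z; rewrite eq_sym => /negPf->. by [].
  apply/setP => -[a b]; rewrite !inE /Ygraph /= !xpair_eqE (negPf x0) /= andbF /=.
  rewrite (eq_sym a x) (_ : (y == ordS b) = (b == z)); last first.
    by rewrite -{1}zS (can_eq (@ordSK n)) eq_sym.
  rewrite (eq_sym y b) andb_orr -!orbA [(a == _) && _]andbC; by rewrite (andbC (b == y)).
rewrite /laplacian /degree_mx /adjacency_mx !mxE !enum_rankK deg (inj_eq enum_rank_inj) xpair_eqE.
rewrite /Ygraph /=.
have [<-{x'}|nx] := eqVneq x x'; rewrite /= ?mulr0n ?add0r.
  have [x0|x0] := eqVneq x ord0; rewrite /= ?andbF /= ?orbF.
    by case: (y == y'); rewrite ?mulr1 ?mulr0 ?mulr0n ?mulr1n.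
  case E1: (y' == ordS y); case E2: (y == ordS y'); rewrite ?mulr_natr //=.
  by move: E1 E2 => /eqP-> /eqP e; have := SSy y; rewrite -e eqxx.
by have [x0|x0] := eqVneq x ord0; have [x'0|x'0] := eqVneq x' ord0; rewrite //= ?andbT ?andbF ?orbF //; move: nx; rewrite x0 x'0.
Qed.

(* Main.v *)
Require Import Defs.
From HB Require Import structures.
From mathcomp Require Import all_boot all_order all_algebra.
From mathcomp Require Import boolp zify ring.

(* Write [R = Z[X]/(X^n - 1)] and [D = 3 - X - X^-1]. The cokernel of the
   Laplacian is the [R]-module on generators [e0 .. e3] with [D e_i = e0] for
   [i > 0] and [3 e0 = e1 + e2 + e3]. Eliminating [e0] and [e3], it becomes
   [R/(D) + R/(3D(D - 1))], generated by [e2 - e1] and [e1]. Up to units, [D]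
   is [E = X^2 - 3X + 1] and [D - 1] is [(X - 1)^2]; these two are comaximal in
   [R]. Put [Q = E (X - 1)^2].

   - A class in [R/(3Q)] has a representative of degree [< n]; dividing it by
     the quartic [Q], the [n - 4] coefficients of the quotient matter modulo
     [3], and the remainder matters modulo three times the ideal
     [(Q, X^n - 1) = (E, X^n - 1) \cap ((X - 1)^2, X^n - 1)].
   - Modulo [(X - 1)^2] one has [X^n - 1 = n (X - 1)], which gives [Z + Z/3n].
   - [Z[X]/(E) = Z[phi]], where [X = phi^2] and [X - 1 = phi]; there [X^n - 1]
     is associated to [phi^n - phi^-n], which is [L_n] for [n] odd and
     [F_n sqrt 5] for [n] even. *)

Set Implicit Arguments.
Unset Strict Implicit.
Unset Printing Implicit Defensive.

Import GRing.Theory Num.Theory.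
Import Pdiv.Ring Pdiv.RingMonic.
Local Open Scope ring_scope.
Local Open Scope quotient_scope.

(** * Ideals with two generators, and the golden ratio *)

Definition ideal2 (R : comNzRingType) (a b p : R) : Prop :=
  exists s t, p = s * a + t * b.

Definition gold : {poly int} := 'X^2 - 3 * 'X + 1.
Definition cyc n : {poly int} := 'X^n - 1.
Definition quart : {poly int} := gold * ('X - 1) ^+ 2.

Section Ideals.
Variable R : comNzRingType.
Implicit Types (a b c p q : R).

Lemma ideal2_modl a b s p : ideal2 a b (s * a + p) <-> ideal2 a b p.
Proof.
split=> -[u [v e]]; first by exists (u - s), v; rewrite mulrBl addrAC -e; ring.
by exists (s + u), v; rewrite e; ring.
Qed.

Lemma ideal2_modr a b s p : ideal2 a b (s * b + p) <-> ideal2 a b p.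
Proof.
split=> -[u [v e]]; first by exists u, (v - s); rewrite mulrBl addrA -e; ring.
by exists u, (s + v); rewrite e; ring.
Qed.

Lemma ideal2_eqr a b c p : ideal2 a c b -> ideal2 a b c ->
  (ideal2 a b p <-> ideal2 a c p).
Proof.
move=> [s [t eb]] [u [v ec]]; split=> -[x [y ->]].
  by exists (x + y * s), (y * t); rewrite eb; ring.
by exists (x + y * u), (y * v); rewrite ec; ring.
Qed.

End Ideals.

(* [y = X - 1] plays the role of the golden ratio modulo [gold = y^2 - y - 1];
   [1 - y] is its conjugate. *)
Lemma binet n :
  (exists s, ('X - 1) ^+ n + (2 - 'X) ^+ n = (lucas n)%:R + s * gold) /\
  (exists s, ('X - 1) ^+ n - (2 - 'X) ^+ n
             = (fib n)%:R * (2 * 'X - 3) + s * gold).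
Proof.
elim/ltn_ind: n => -[|[|n]] IH.
- by split; exists 0; rewrite /= !expr0; ring.
- by split; exists 0; rewrite /= !expr1; ring.
have [[s1 e1] [t1 f1]] := IH n.+1 (ltnSn _).
have [[s0 e0] [t0 f0]] := IH n (ltnW (ltnSn _)).
(* [gold] equals t^2 - t - 1 both for t = X - 1 and for t = 2 - X, so both power sequences satisfy
   the Fibonacci recurrence modulo [gold]. *)
have yS : ('X - 1) ^+ n.+2
    = ('X - 1) ^+ n.+1 + ('X - 1) ^+ n + gold * ('X - 1) ^+ n :> {poly int}.
  by rewrite !exprS /gold; ring.
have zS : (2 - 'X) ^+ n.+2
    = (2 - 'X) ^+ n.+1 + (2 - 'X) ^+ n + gold * (2 - 'X) ^+ n :> {poly int}.
  by rewrite !exprS /gold; ring.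
have -> : lucas n.+2 = (lucas n.+1 + lucas n)%N by [].
have -> : fib n.+2 = (fib n.+1 + fib n)%N by [].
rewrite yS zS !natrD; split.
  exists (s1 + s0 + ('X - 1) ^+ n + (2 - 'X) ^+ n).
  have -> : (lucas n.+1)%:R = ('X - 1) ^+ n.+1 + (2 - 'X) ^+ n.+1 - s1 * gold.
    by rewrite e1; ring.
  have -> : (lucas n)%:R = ('X - 1) ^+ n + (2 - 'X) ^+ n - s0 * gold.
    by rewrite e0; ring.
  ring.
exists (t1 + t0 + ('X - 1) ^+ n - (2 - 'X) ^+ n).
rewrite [X in _ = X + _]mulrDl.
have -> : (fib n.+1)%:R * (2 * 'X - 3)
    = ('X - 1) ^+ n.+1 - (2 - 'X) ^+ n.+1 - t1 * gold.
  by rewrite f1; ring.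
have -> : (fib n)%:R * (2 * 'X - 3) = ('X - 1) ^+ n - (2 - 'X) ^+ n - t0 * gold.
  by rewrite f0; ring.
ring.
Qed.

(** Serves to raise the congruences X = (X - 1)^2 and (X - 1)(X - 2) = 1 modulo [gold] to the power
    n. *)
Lemma expr_cong (R : comNzRingType) (a b c : R) n :
  exists s, (a + b * c) ^+ n = a ^+ n + s * c.
Proof.
elim: n => [|n [s IH]]; first by exists 0; rewrite !expr0; ring.
by exists (a * s + b * a ^+ n + b * s * c); rewrite !exprS IH; ring.
Qed.

(* Modulo [gold], [X = y^2], so that [X^n - 1 = y^n (y^n - y^-n)] where
   [y^-1 = y - 1]. *)
Lemma ideal2_gold_cyc n c s p :
  ('X - 1) ^+ n - ('X - 2) ^+ n = c + s * gold ->
  ideal2 gold (cyc n) p <-> ideal2 gold c p.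
Proof.
move=> ec.
have [k ek] := expr_cong (('X - 1) ^+ 2) (-1) gold n.
have eX : 'X = ('X - 1) ^+ 2 + -1 * gold by rewrite /gold; ring.
rewrite -eX in ek.
have [l el] := expr_cong 1 1 gold n.
have e1 : 1 + 1 * gold = ('X - 1) * ('X - 2) by rewrite /gold; ring.
rewrite e1 expr1n exprMn in el.
move: ek el ec; rewrite -exprM mulnC exprM expr2 /cyc.
move: (('X - 1) ^+ n) (('X - 2) ^+ n) => y z ek el ec.
have -> : c = y - z - s * gold by rewrite ec; ring.
have -> : 'X^n - 1 = y * y - y * z + l * gold + k * gold by rewrite ek el; ring.
apply: ideal2_eqr.
  by exists (l + k + y * s), y; ring.
exists (- s - l * (y - z) - z * (l + k)), z.
have -> : z * (y * y - y * z + l * gold + k * gold)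
   = (y * z) * (y - z) + z * (l + k) * gold by ring.
rewrite el; ring.
Qed.

(** * Ideals of integer polynomials *)

Lemma goldE : gold = Poly [:: 1; -3; 1].
Proof.
by rewrite /= !cons_poly_def -[0%:P]/(0 : {poly int}) /gold polyCN polyC1; ring.
Qed.

Lemma quartE : quart = Poly [:: 1; -5; 8; -5; 1].
Proof.
rewrite /= !cons_poly_def -[0%:P]/(0 : {poly int}) /quart /gold polyCN polyC1.
ring.
Qed.

Lemma size_gold : size gold = 3%N.
Proof. by rewrite goldE (@PolyK _ 0). Qed.

Lemma size_quart : size quart = 5%N.
Proof. by rewrite quartE (@PolyK _ 0). Qed.

Lemma monic_gold : gold \is monic.
Proof. by rewrite monicE /lead_coef size_gold goldE (@PolyK _ 0). Qed.

Lemma monic_quart : quart \is monic.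
Proof. by rewrite monicE /lead_coef size_quart quartE (@PolyK _ 0). Qed.

Lemma size_cyc n : (0 < n)%N -> size (cyc n) = n.+1.
Proof. exact: size_XnsubC. Qed.

Lemma monic_cyc n : (0 < n)%N -> cyc n \is monic.
Proof. exact: monicXnsubC. Qed.

Lemma poly_size_leP (R : nzRingType) (p : {poly R}) k : (size p <= k)%N ->
  p = \sum_(i < k) (p`_i)%:P * 'X^i.
Proof.
move=> pk; under eq_bigr do rewrite mul_polyC.
rewrite -poly_def; apply/polyP => i; rewrite coef_poly.
by case: ltnP => // ki; rewrite nth_default // (leq_trans pk).
Qed.

Definition gold0 p : int := (rmodp p gold)`_0.
Definition gold1 p : int := (rmodp p gold)`_1.

Lemma gold_remE p :
  p = rdivp p gold * gold + ((gold0 p)%:P + (gold1 p)%:P * 'X).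
Proof.
have r2 : (size (rmodp p gold) <= 2)%N.
  by rewrite -ltnS -size_gold ltn_rmodp monic_neq0 // monic_gold.
rewrite {1}(rdivp_eq monic_gold p); congr (_ + _).
rewrite {1}(poly_size_leP r2) !big_ord_recr big_ord0 /=; ring.
Qed.

(** Since [gold] is monic of degree 2, the classes of 1 and X form a basis of Z[X]/([gold]);
    coordinates there can thus be compared. *)
Lemma gold_linear_eq0 (a b : int) s :
  a%:P + b%:P * 'X = s * gold -> a = 0 /\ b = 0.
Proof.
move=> e; have := rmodp_mull monic_gold s; rewrite -e rmodp_small; last first.
  rewrite size_gold addrC size_MXaddC; case: ifP => // _.
  by rewrite !ltnS size_polyC leq_b1.
move=> /polyP z; have := z 0%N; have := z 1%N.
by rewrite !coefE /= mulr0 mulr1 add0r addr0.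
Qed.

Lemma polyC_posz (d : nat) : (d%:Z)%:P = d%:R :> {poly int}.
Proof. by rewrite -natz rmorph_nat. Qed.

Lemma ideal2_gold_nat (d : nat) (a b : int) :
  ideal2 gold d%:R (a%:P + b%:P * 'X) <-> (d %| a)%Z /\ (d %| b)%Z.
Proof.
split=> [[s [t e]]|[/dvdzP[k ->] /dvdzP[l ->]]]; last first.
  exists 0, (k%:P + l%:P * 'X); rewrite !rmorphM /= polyC_posz; ring.
move: (gold_remE t); move: (rdivp t gold) (gold0 t) (gold1 t) => q x y et.
have [] := @gold_linear_eq0 (a - x * d) (b - y * d) (s + q * d%:R).
  rewrite !rmorphB !rmorphM /= polyC_posz.
  have -> : a%:P = s * gold + t * d%:R - b%:P * 'X :> {poly int}.
    by rewrite -e; ring.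
  by rewrite et; ring.
by move=> /eqP; rewrite subr_eq0 => /eqP-> /eqP; rewrite subr_eq0 => /eqP->;
  rewrite !dvdz_mull.
Qed.

(* [2X - 3] is the square root of 5 modulo [gold]. *)
Lemma ideal2_gold_sqrt5 (d : nat) (a b : int) :
  ideal2 gold (d%:R * (2 * 'X - 3)) (a%:P + b%:P * 'X) <->
  (d %| a + b)%Z /\ ((5 * d)%N %| 2 * a + 3 * b)%Z.
Proof.
split=> [[s [t e]]|[/dvdzP[k ek] /dvdzP[l el]]].
  move: (gold_remE t); move: (rdivp t gold) (gold0 t) (gold1 t) => q x y et.
  (* Modulo [gold], multiplication by 2X - 3 sends x + yX to -(3x + 2y) + (2x + 3y)X. The forms a +
     b and 2a + 3b make this triangular, with values (y - x)d and 5yd. *)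
  have [] := @gold_linear_eq0
    (a + (3 * x + 2 * y) * d) (b - (2 * x + 3 * y) * d)
    (s + q * d%:R * (2 * 'X - 3) + 2 * y%:P * d%:R).
    rewrite rmorphD rmorphB !rmorphM /= polyC_posz.
    have -> : a%:P = s * gold + t * (d%:R * (2 * 'X - 3)) - b%:P * 'X
        :> {poly int}.
      by rewrite -e; ring.
    by rewrite et /gold; ring.
  move=> ea eb; split; apply/dvdzP; [exists (y - x)|exists y]; lia.
have -> : b = (5 * l - 2 * k) * d by lia.
have -> : a = (3 * k - 5 * l) * d by lia.
exists (- 2 * (l%:P) * d%:R), ((l - k)%:P + l%:P * 'X).
rewrite !rmorphM /= polyC_posz /gold; ring.
Qed.

Lemma poly_dvdzP (d : int) (p : {poly int}) :
  (forall i, (d %| p`_i)%Z) -> exists q, p = d%:P * q.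
Proof.
move=> dp; exists (map_poly (divz^~ d) p); apply/polyP=> i.
by rewrite coefCM coef_map_id0 ?div0z // mulrC divzK.
Qed.

(** The size bound is what allows [d] to be taken out: [b] has quotient 0 by the monic [cyc n], and
    comparison with the division of [s * a] shows that [t] is a multiple of [d]. Without the bound
    [cyc n] itself would be a counterexample. *)
Lemma ideal2_scale_cyc n (d : int) (a b : {poly int}) :
  (0 < n)%N -> (size b <= n)%N ->
  ideal2 (d%:P * a) (cyc n) b <-> exists2 c, b = d%:P * c & ideal2 a (cyc n) c.
Proof.
move=> n0 bn; split=> [[s [t e]]|[_ -> [s [t ->]]]]; last first.
  by exists s, (d%:P * t); ring.
suff [u tu] : exists u, t = d%:P * u.
  by exists (s * a + u * cyc n); [rewrite e tu; ring | exists s, u].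
exists (- rdivp (s * a) (cyc n)).
have /monic_cyc mN := n0.
have: rdivp b (cyc n) = 0 by rewrite rdivp_small ?size_cyc.
have := rdivp_eq mN (s * a).
move: (rdivp (s * a) _) (rmodp (s * a) _) (ltn_rmodp (s * a) (cyc n)) => q r.
rewrite monic_neq0 // => rN sa.
rewrite e mulrCA sa.
have -> : d%:P * (q * cyc n + r) + t * cyc n
    = (d%:P * q + t) * cyc n + d%:P * r.
  by ring.
rewrite rdivp_addl_mul_small //.
  by move=> /eqP; rewrite addrC addr_eq0 => /eqP->; ring.
by apply: leq_ltn_trans rN; rewrite mul_polyC size_scale_leq.
Qed.

(** Comaximality: (X - 1)^2 - [gold] = X is a unit modulo X^n - 1, so the intersection of the two
    ideals is their product. *)
Lemma ideal2_quart n p : (0 < n)%N -> ideal2 quart (cyc n) p <->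
  ideal2 gold (cyc n) p /\ ideal2 (('X - 1) ^+ 2) (cyc n) p.
Proof.
move=> n0; split=> [[s [t ->]]|[[s [t e]] [u [v f]]]].
  split; [exists (s * ('X - 1) ^+ 2), t|exists (s * gold), t] => //;
  by rewrite /quart; ring.
(* X^(n-1) inverts X modulo [cyc n], so it is enough to treat ['X * p]. *)
have pE : p = 'X^(n.-1) * ('X * p) - p * cyc n.
  by rewrite /cyc mulrA -exprSr prednK //; ring.
have XpE : 'X * p = (s - u) * quart
   + (('X - 1) ^+ 2 * t - gold * v) * cyc n.
  have -> : 'X * p = (('X - 1) ^+ 2 - gold) * p by rewrite /gold; ring.
  by rewrite mulrBl {1}e f /quart; ring.
exists ('X^(n.-1) * (s - u)),
  ('X^(n.-1) * (('X - 1) ^+ 2 * t - gold * v) - p).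
by rewrite {1}pE XpE; ring.
Qed.

(** The first-order Taylor expansion of X^n - 1 at 1. *)
Lemma cyc_mod_sqr n : exists s, cyc n = n%:R * ('X - 1) + s * ('X - 1) ^+ 2.
Proof.
elim: n => [|n [s IH]]; first by exists 0; rewrite /cyc expr0; ring.
exists (n%:R + s * 'X).
have -> : cyc n.+1 = 'X * cyc n + ('X - 1) by rewrite /cyc exprS; ring.
by rewrite IH -natr1; ring.
Qed.

Lemma hornerM_X1 (q : {poly int}) : (q * ('X - 1)).[1] = 0.
Proof. by rewrite -polyC1 hornerM hornerXsubC subrr mulr0. Qed.

Lemma deriv_hornerM_X1 (q : {poly int}) : (q * ('X - 1))^`().[1] = q.[1].
Proof.
by rewrite derivM hornerD -polyC1 derivXsubC hornerM hornerXsubC subrr mulr0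
  add0r mulr1.
Qed.

(** The ideal is generated by (X - 1)^2 and n(X - 1), and modulo (X - 1)^2 a polynomial amounts to
    its value and derivative at 1. *)
Lemma ideal2_sqr_cyc n (p : {poly int}) : ideal2 (('X - 1) ^+ 2) (cyc n) p <->
  p.[1] = 0 /\ (n %| p^`().[1])%Z.
Proof.
have [s es] := cyc_mod_sqr n; split=> [[u [v ->]]|].
  have -> : u * ('X - 1) ^+ 2 + v * cyc n
      = ((u + v * s) * ('X - 1) + v * n%:Z%:P) * ('X - 1).
    by rewrite es polyC_posz; ring.
  rewrite hornerM_X1 deriv_hornerM_X1 hornerD hornerM_X1 add0r hornerM hornerC.
  by rewrite dvdz_mull.
move=> [/eqP/factor_theorem[q ->]]; rewrite polyC1 deriv_hornerM_X1.
move=> /dvdzP[k qk].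
have /factor_theorem[r] : root (q - q.[1]%:P) 1.
  by rewrite rootE hornerD hornerN hornerC subrr.
rewrite polyC1 qk => er.
exists (r - k%:P * s), k%:P.
have -> : q = r * ('X - 1) + k%:P * n%:R.
  by rewrite -er rmorphM /= polyC_posz; ring.
by rewrite es; ring.
Qed.

(** * Cokernels and the Laplacian *)

(* A map to [T x int] with kernel the image of [A], and onto [T x 0], shows
   that the torsion of the cokernel is [T]. *)
Lemma torsion_coker_iso m n (A : 'M[int]_(m, n)) (T : zmodType)
    (g : 'cV[int]_m -> T) (d : 'cV[int]_m -> int) :
    zmod_morphism g -> zmod_morphism d ->
    (forall u, u \in mximage A <-> g u = 0 /\ d u = 0) ->
    (forall t, exists2 u, g u = t & d u = 0) ->
    (exists2 k : nat, (0 < k)%N & forall t : T, t *+ k = 0) ->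
  group_iso (torsion_subgroup (coker A)) T.
Proof.
move=> gB dB im surj [k k0 kT].
pose gA : {additive _ -> _} := HB.pack g (GRing.isZmodMorphism.Build _ _ g gB).
pose dA : {additive _ -> _} := HB.pack d (GRing.isZmodMorphism.Build _ _ d dB).
have gE u v : u - v \in mximage A -> g u = g v.
  by move=> /im[+ _]; rewrite gB => /eqP; rewrite subr_eq0 => /eqP.
have dE u v : u - v \in mximage A -> d u = d v.
  by move=> /im[_]; rewrite dB => /eqP; rewrite subr_eq0 => /eqP.
have piE (u v : 'cV[int]_m) :
    (\pi_(coker A) u = \pi_(coker A) v) <-> u - v \in mximage A.
  by rewrite Quotient.idealrBE; split=> /eqP.
pose F (x : torsion_subgroup (coker A)) : T := g (repr (torsion_val x)).
have FB : zmod_morphism F.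
  move=> x y; rewrite /F -gB; apply: gE; apply/piE.
  by rewrite raddfB /= !reprK.
have F0 x : F x = 0 -> x = 0.
  move=> gx; apply: val_inj => /=.
  have /asboolP[l l0 xl] := torsion_valP x.
  have : repr (torsion_val x) \in mximage A.
    apply/im; split=> //.
    (* A positive multiple of the representative lies in the image of [A], where [d] vanishes; as
       [int] is torsion-free, [d] vanishes on the representative too. *)
    have : \pi_(coker A) (repr (torsion_val x) *+ l) = \pi_(coker A) 0.
      by rewrite raddfMn raddf0 /= reprK.
    move=> /piE; rewrite subr0 => /im[_].
    rewrite -[d _]/(dA _) raddfMn /= => /eqP.
    by rewrite mulrn_eq0 eqn0Ngt l0 => /eqP.
  rewrite -[X in X \in _]subr0 => /piE; by rewrite reprK raddf0.
have Fs t : exists x, F x = t.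
  have [u gu du] := surj t.
  have tu : \pi_(coker A) u \in @torsion (coker A).
    apply/asboolP; exists k => //; rewrite -raddfMn.
    rewrite -[RHS](raddf0 \pi_(coker A)).
    apply/piE; rewrite subr0; apply/im.
    by rewrite -[g _]/(gA _) -[d _]/(dA _) !raddfMn /= kT du mul0rn.
  exists (TorsionElt tu); rewrite /F /= -gu; apply: gE; apply/piE.
  by rewrite reprK.
pose FA : {additive _ -> _} := HB.pack F (GRing.isZmodMorphism.Build _ _ F FB).
have [G GK] := choice Fs.
exists FA, G => //= x; apply/eqP; rewrite -subr_eq0; apply/eqP/F0.
by rewrite FB GK subrr.
Qed.

Lemma ord4P (x : 'I_4) : [\/ x = 0, x = 1, x = 2 | x = 3].
Proof.
case: x => -[|[|[|[|//]]]] h;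
  [apply: Or41|apply: Or42|apply: Or43|apply: Or44]; exact: val_inj.
Qed.

(** * The Laplacian as an operator on polynomials modulo X^n - 1 *)

Section Laplacian.
Variable n : nat.
Hypothesis n2 : (2 < n)%N.
Local Notation V := ('I_4 * 'I_n)%type.
Local Notation L := (laplacian (@Ygraph n)).

(** Represents, in degree below n, an element of Z[X]/(X^n - 1), where cyclic shifts become
    multiplication by powers of X. *)
Definition layer (u : 'cV[int]_#|{: V}|) (x : 'I_4) : {poly int} :=
  rVpoly (\row_y u (enum_rank (x, y)) 0).

Lemma size_layer u x : (size (layer u x) <= n)%N.
Proof. exact: size_poly. Qed.

Lemma layerB u v x : layer (u - v) x = layer u x - layer v x.
Proof.
by rewrite /layer -raddfB; congr rVpoly; apply/rowP => y; rewrite !mxE.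
Qed.

Lemma layer_inj u v : (forall x, layer u x = layer v x) -> u = v.
Proof.
move=> uv; apply/colP => i; rewrite -[i]enum_valK; case: (enum_val i) => x y.
by have := uv x; move=> /(can_inj rVpolyK)/rowP/(_ y); rewrite !mxE.
Qed.

Lemma layer_surj (p : 'I_4 -> {poly int}) : (forall x, (size (p x) <= n)%N) ->
  exists u, forall x, layer u x = p x.
Proof.
move=> pn.
exists (\col_(i < #|{: V}|) (p (enum_val i).1)`_((enum_val i).2 : 'I_n)) => x.
rewrite -[RHS](poly_rV_K (pn x)); congr rVpoly; apply/rowP => y.
by rewrite !mxE enum_rankK.
Qed.

(** Multiplication by X moves each coefficient up one place; only the entry of index 0, which wraps
    around, lands in degree n instead of 0. *)
Lemma rVpoly_shift (w : 'rV[int]_n) :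
  exists c, 'X * rVpoly (\row_y w 0 (ordS y)) = rVpoly w + c%:P * cyc n.
Proof.
have n0 : (0 < n)%N by apply: leq_trans n2.
exists (w 0 (Ordinal n0)); apply/polyP => i.
rewrite coefD coefCM coefB coefXn coef1 coefXM.
case: i => [|i] /=.
  rewrite -[X in (rVpoly w)`_X]/(val (Ordinal n0)) coef_rVpoly_ord.
  by rewrite (ltn_eqF n0) sub0r mulrN1 addrN.
rewrite subr0.
case: (ltnP i n) => [lt_in|le_ni]; last first.
  rewrite !nth_default ?(leq_trans (size_poly _ _)) ?(leqW le_ni) //.
  by rewrite gtn_eqF ?mulr0 ?addr0 // ltnS.
rewrite -[X in _`_X]/(val (Ordinal lt_in)) coef_rVpoly_ord mxE.
case: (ltnP i.+1 n) => [lt_Sin|le_nSi].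
  rewrite -[X in _`_X]/(val (Ordinal lt_Sin)) coef_rVpoly_ord.
  rewrite ltn_eqF // mulr0 addr0; congr (w 0 _); apply: val_inj.
  by rewrite /= modn_small.
rewrite [in RHS]nth_default ?(leq_trans (size_poly _ _)) // add0r.
have e : i.+1 = n by apply/eqP; rewrite eqn_leq lt_in.
rewrite e eqxx mulr1; congr (w 0 _); apply: val_inj.
by rewrite /= e modnn.
Qed.

Lemma sum_delta (f : 'I_n -> int) y : \sum_z (y == z)%:R * f z = f y.
Proof.
rewrite (bigD1 y) //= eqxx mul1r big1 ?addr0 // => z.
by rewrite eq_sym => /negPf->; rewrite mul0r.
Qed.

Lemma laplacian_mulE (v : 'cV[int]_#|{: V}|) (x : 'I_4) (y : 'I_n) :
  (L *m v) (enum_rank (x, y)) 0 =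
  let f := fun (x : 'I_4) (y : 'I_n) => v (enum_rank (x, y)) 0 in
  if x == 0 then 3 * f 0 y - f 1 y - f 2 y - f 3 y
  else 3 * f x y - f x (ordS y) - f x (ord_pred y) - f 0 y.
Proof.
pose f (x : 'I_4) (y : 'I_n) := v (enum_rank (x, y)) 0; rewrite -/f /=.
pose K x' y' : int := if x == x' then
    3 * (y == y')%:R
      - (if x == ord0 then 0 else (y' == ordS y)%:R + (y == ordS y')%:R)
  else if (x == ord0) || (x' == ord0) then - (y == y')%:R else 0.
transitivity (\sum_x' \sum_y' K x' y' * f x' y').
  rewrite pair_bigA mxE (reindex _ (onW_bij _ (enum_rank_bij _))) /=.
  by apply: eq_bigr => -[x' y'] _; rewrite laplacian_YgraphE.
have row x' : \sum_y' K x' y' * f x' y' = if x == x' then 3 * f x' y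
      - (if x == ord0 then 0 else f x' (ordS y) + f x' (ord_pred y))
    else if (x == ord0) || (x' == ord0) then - f x' y else 0.
  have ordSE y' : (y == ordS y') = (ord_pred y == y').
    by rewrite (can2_eq (@ord_predK n) (@ordSK n)).
  rewrite /K; case: (x == x').
    under eq_bigr do rewrite mulrBl -mulrA.
    rewrite sumrB -mulr_sumr sum_delta; case: (x == _).
      by congr (_ - _); rewrite big1 // => i; rewrite mul0r.
    under eq_bigr do rewrite mulrDl ordSE eq_sym.
    by rewrite big_split /= !sum_delta.
  case: (_ || _); last by rewrite big1 // => i; rewrite mul0r.
  by under eq_bigr do rewrite mulNr; rewrite sumrN sum_delta.
rewrite (eq_bigr _ (fun x' _ => row x')) !big_ord_recl big_ord0.
have e1 : lift ord0 ord0 = 1 :> 'I_4 by apply: val_inj.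
have e2 : lift ord0 (lift ord0 ord0) = 2 :> 'I_4 by apply: val_inj.
have e3 : lift ord0 (lift ord0 (lift ord0 ord0)) = 3 :> 'I_4 by apply: val_inj.
rewrite e3 e2 e1 -[ord0]/(0 : 'I_4).
by case: (ord4P x) => ->; rewrite /=; ring.
Qed.

(* Modulo [X^n - 1], the monomial [X^(n-1)] is the inverse of [X]. *)
Definition shiftD n : {poly int} := 3 - 'X - 'X^(n.-1).

(* The coordinates of [u] on the generators [e2 - e1] and [e1] that remain
   after eliminating [e0] and [e3]. *)
Definition reduced1 u := layer u 2 - layer u 3.

Definition reduced2 u := layer u 1 + layer u 2 - 2 * layer u 3
  + shiftD n * (layer u 0 + 3 * layer u 3).

Lemma layer_laplacian0 v :
  layer (L *m v) 0 = 3 * layer v 0 - layer v 1 - layer v 2 - layer v 3.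
Proof.
rewrite mulr_natl -(raddfMn (@rVpoly _ n)) -!raddfB; congr rVpoly.
by apply/rowP => y; rewrite mxE laplacian_mulE /= !mxE; ring.
Qed.

Lemma cycE : cyc n = 'X * 'X^(n.-1) - 1.
Proof. by rewrite -exprS prednK // (leq_trans _ n2). Qed.

Lemma layer_laplacian v x : x != 0 ->
  exists m, layer (L *m v) x = shiftD n * layer v x - layer v 0 + m * cyc n.
Proof.
move=> /negPf x0; pose w := \row_y v (enum_rank (x, y)) 0.
pose wl := \row_y w 0 (ordS y); pose wr := \row_y w 0 (ord_pred y).
have -> : layer (L *m v) x
    = 3 * layer v x - rVpoly wl - rVpoly wr - layer v 0.
  rewrite mulr_natl -(raddfMn (@rVpoly _ n)) -!raddfB; congr rVpoly.
  by apply/rowP => y; rewrite mxE laplacian_mulE /= x0 !mxE; ring.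
(* Shifting [wr] gives back [w], so [wr] is X times [w] modulo [cyc n], whereas [wl] is X^(n-1)
   times [w]. *)
have [c ec] := rVpoly_shift w; have [d] := rVpoly_shift wr.
rewrite (_ : \row__ _ = w); last by apply/rowP => y; rewrite !mxE ordSK.
move=> ed.
exists (rVpoly wl - 'X^(n.-1) * c%:P + d%:P).
have -> : rVpoly wr = 'X * layer v x - d%:P * cyc n by rewrite ed; ring.
have {1}-> : rVpoly wl = 'X^(n.-1) * ('X * rVpoly wl) - rVpoly wl * cyc n.
  by rewrite cycE; ring.
by rewrite ec /shiftD -/(layer v x); ring.
Qed.

(** Representatives of degree below n are unique, so an equation between vectors need only be
    checked modulo [cyc n]. *)
Lemma layer_cong_inj u v (m : 'I_4 -> {poly int}) :
  (forall x, layer u x = layer v x + m x * cyc n) -> u = v.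
Proof.
move=> uv; apply: layer_inj => x; have n0 : (0 < n)%N by apply: leq_trans n2.
have := congr1 (fun p => rmodp p (cyc n)) (uv x).
rewrite rmodpD ?rmodp_mull ?monic_cyc // addr0.
by rewrite !rmodp_small // size_cyc // ltnS size_layer.
Qed.

Lemma layer_surj_cong (p : 'I_4 -> {poly int}) :
  exists v, exists m : 'I_4 -> {poly int}, forall x,
    layer v x = p x + m x * cyc n.
Proof.
have n0 : (0 < n)%N by apply: leq_trans n2.
have [x|v vp] := @layer_surj (fun x => rmodp (p x) (cyc n)).
  by rewrite -ltnS -(size_cyc n0) ltn_rmodp monic_neq0 // monic_cyc.
exists v, (fun x => - rdivp (p x) (cyc n)) => x; rewrite vp.
by rewrite [X in _ = X + _](rdivp_eq (monic_cyc n0)); ring.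
Qed.

(** For u = Lv with layers v0 .. v3, the reduced coordinates are D(v2 - v3) and 3D(D - 1)v3 modulo
    [cyc n]: all other unknowns cancel. Conversely, these two values allow a preimage to be
    rebuilt. *)
Lemma mximage_laplacianP u : u \in mximage L <->
  ideal2 gold (cyc n) (reduced1 u) /\
  ideal2 (3%:P * quart) (cyc n) (reduced2 u).
Proof.
rewrite /reduced1 /reduced2; set D := shiftD n.
have goldD : gold = - 'X * D - cyc n by rewrite cycE /gold /D /shiftD; ring.
have sqrD : ('X - 1) ^+ 2 = - 'X * (D - 1) - cyc n.
  by rewrite cycE /D /shiftD; ring.
have XY : 'X * 'X^(n.-1) = 1 + cyc n by rewrite cycE; ring.
have Dgold : D = - 'X^(n.-1) * gold - ('X^(n.-1) + D) * cyc n.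
  by rewrite goldD mulrBr mulNr mulNr mulrN opprK mulrA (mulrC _ 'X) XY; ring.
have Dsqr : D - 1 = - 'X^(n.-1) * ('X - 1) ^+ 2 - ('X^(n.-1) + D - 1) * cyc n.
  by rewrite sqrD mulrBr mulNr mulNr mulrN opprK mulrA (mulrC _ 'X) XY; ring.
split=> [/asboolP[v ->]|].
  rewrite layer_laplacian0.
  have [m1 ->] := @layer_laplacian v 1 isT.
  have [m2 ->] := @layer_laplacian v 2 isT.
  have [m3 ->] := @layer_laplacian v 3 isT.
  rewrite -/D.
  move: (layer v 0) (layer v 1) (layer v 2) (layer v 3) => q0 q1 q2 q3.
  move: Dgold Dsqr; move: ('X^(n.-1)) => Y Dgold Dsqr.
  split.
    have -> : D * q2 - q0 + m2 * cyc n - (D * q3 - q0 + m3 * cyc n)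
        = D * (q2 - q3) + (m2 - m3) * cyc n by ring.
    rewrite {1}Dgold; exists (- Y * (q2 - q3)),
      (m2 - m3 - (Y + D) * (q2 - q3)); ring.
  set r := (X in ideal2 _ _ X).
  have -> : r = 3%:P * q3 * (D * (D - 1))
      + (m1 + m2 - 2 * m3 + 3 * D * m3) * cyc n by rewrite /r; ring.
  have [w ->] : exists w, D * (D - 1) = Y ^+ 2 * quart + w * cyc n.
    exists (Y * gold * (Y + D - 1)
      + (Y + D) * (Y * ('X - 1) ^+ 2 + (Y + D - 1) * cyc n)).
    by rewrite Dsqr {1}Dgold /quart; ring.
  exists (q3 * Y ^+ 2), (3%:P * q3 * w + (m1 + m2 - 2 * m3 + 3 * D * m3)).
  ring.
move=> [[s [t e]] [r [m f]]].
(* Modulo [cyc n], [gold] is -XD and [quart] is X^2 D(D - 1). This yields [q3] from [r] and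
   [q2 - q3] from [s]; block row 3 then gives [q0], and block row 0 gives [q1]. *)
pose q3 := 'X ^+ 2 * r; pose q0 := D * q3 - layer u 3.
pose q2 := q3 - 'X * s; pose q1 := 3 * q0 - q2 - q3 - layer u 0.
have [v [k vk]] := layer_surj_cong (fun x => if x == 0 then q0
  else if x == 1 then q1 else if x == 2 then q2 else q3).
apply/asboolP; exists v.
suff cong x : exists m, layer u x = layer (L *m v) x + m * cyc n.
  have [m' mE] := choice cong; exact: layer_cong_inj mE.
have u2E : layer u 2 = layer u 3 + s * gold + t * cyc n.
  by rewrite -addrA -e; ring.
have u1E : layer u 1 = r * (3%:P * quart) + m * cyc n - layer u 2
    + 2 * layer u 3 - D * (layer u 0 + 3 * layer u 3).
  by rewrite -f; ring.
have [m1 e1] := @layer_laplacian v 1 isT.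
have [m2 e2] := @layer_laplacian v 2 isT.
have [m3 e3] := @layer_laplacian v 3 isT.
have := vk 3; have := vk 2; have := vk 1; have := vk 0; rewrite /=.
move=> v0 v1 v2 v3.
rewrite -/D v0 ?v1 ?v2 ?v3 in e1 e2 e3.
case: (ord4P x) => ->.
- exists (k 1 + k 2 + k 3 - 3 * k 0); rewrite layer_laplacian0 v0 v1 v2 v3.
  by rewrite /q1; ring.
- exists (m + 3 * r * ('X * (D - 1) + 'X * D + cyc n) - (t - s)
    - (D * k 1 - k 0 + m1)).
  rewrite e1 u1E u2E /q1 /q2 /q0 /q3 /quart sqrD goldD; ring.
- exists (t - s - (D * k 2 - k 0 + m2)).
  rewrite e2 u2E /q2 /q0 /q3 goldD; ring.
- exists (- (D * k 3 - k 0 + m3)).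
  by rewrite e3 /q0; ring.
Qed.

End Laplacian.

(** * Coordinates on the cokernel *)

Lemma rdivpB (R : nzRingType) (d p q : {poly R}) : d \is monic ->
  rdivp (p - q) d = rdivp p d - rdivp q d.
Proof.
move=> md; rewrite {1}(rdivp_eq md p) {1}(rdivp_eq md q) opprD addrACA -mulrBl.
rewrite -rmodpB // rdivp_addl_mul_small //.
by rewrite ltn_rmodp monic_neq0.
Qed.

Lemma rdivpZ (R : comNzRingType) (d : {poly R}) c p : d \is monic ->
  rdivp (c *: p) d = c *: rdivp p d.
Proof.
move=> md; rewrite {1}(rdivp_eq md p) scalerDr scalerAl -rmodpZ //.
by rewrite rdivp_addl_mul_small // ltn_rmodp monic_neq0.
Qed.

Lemma leq_size_rdivp (R : nzRingType) (d p : {poly R}) : d \is monic ->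
  (size (rdivp p d) <= size p - (size d).-1)%N.
Proof.
move=> md; have [-> |q0] := eqVneq (rdivp p d) 0; first by rewrite size_poly0.
have dq : (size d <= size (rdivp p d * d)%R)%N.
  rewrite size_Mmonic //; move: q0; rewrite -size_poly_gt0; lia.
rewrite {2}(rdivp_eq md p) size_polyDl; last first.
  by apply: leq_trans dq; rewrite ltn_rmodp monic_neq0.
rewrite size_Mmonic //; have := monic_neq0 md; rewrite -size_poly_gt0; lia.
Qed.

(** For d < 2 the type ['Z_d] is Z/2, hence the bound on [d]. *)
Lemma Zp_intr_eq0 (d : nat) (z : int) : (1 < d)%N ->
  (z%:~R = 0 :> 'Z_d) <-> (d %| z)%Z.
Proof.
move=> d1; have nat0 m : (m%:R = 0 :> 'Z_d) <-> (d %| m)%N.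
  split=> [/(congr1 val)|/eqP dm]; first by rewrite /= val_Zp_nat // => /eqP.
  by apply: val_inj; rewrite /= val_Zp_nat.
case: z => m; rewrite dvdzE /= -nat0 // NegzE mulrNz -pmulrn.
by split=> /eqP; rewrite ?oppr_eq0 => /eqP // ->; rewrite oppr0.
Qed.

Lemma Zp_intr_surj (d : nat) (x : 'Z_d) : exists z : int, z%:~R = x.
Proof. by exists (x : nat)%:Z; rewrite -pmulrn natr_Zp. Qed.

Lemma pairB (S T : zmodType) (a c : S) (b d : T) :
  (a, b) - (c, d) = (a - c, b - d).
Proof. by []. Qed.

Definition bounded_exponent (T : zmodType) : Prop :=
  exists2 k : nat, (0 < k)%N & forall t : T, t *+ k = 0.

Lemma bounded_Zp d : bounded_exponent 'Z_d.
Proof.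
exists (Zp_trunc d).+2 => // t; rewrite -mulr_natr.
have -> : (Zp_trunc d).+2%:R = 0 :> 'Z_d.
  exact: (@pchar_Zp (Zp_trunc d).+2 isT).
by rewrite mulr0.
Qed.

Lemma bounded_rV (T : zmodType) m :
  bounded_exponent T -> bounded_exponent 'rV[T]_m.
Proof.
move=> [k k0 kT]; exists k => // v; apply/rowP => i.
by rewrite mulmxnE kT mxE.
Qed.

Lemma bounded_prod (S T : zmodType) :
  bounded_exponent S -> bounded_exponent T -> bounded_exponent (S * T)%type.
Proof.
move=> [k k0 kS] [l l0 lT]; exists (k * l)%N; first by rewrite muln_gt0 k0.
move=> t; rewrite [LHS]surjective_pairing (raddfMn fst) (raddfMn snd) /=.
by rewrite mulrnA kS mul0rn mulnC mulrnA lT mul0rn.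
Qed.

Lemma gold_rem_eq p q a b : p = q * gold + (a%:P + b%:P * 'X) ->
  gold0 p = a /\ gold1 p = b.
Proof.
move=> e; have pE := gold_remE p.
have [] := @gold_linear_eq0 (gold0 p - a) (gold1 p - b) (q - rdivp p gold).
  rewrite !polyCB mulrBl mulrBl.
  have -> : q * gold = rdivp p gold * gold
      + ((gold0 p)%:P + (gold1 p)%:P * 'X) - (a%:P + b%:P * 'X).
    by rewrite -pE e addrK.
  ring.
by move=> /eqP; rewrite subr_eq0 => /eqP-> /eqP; rewrite subr_eq0 => /eqP->.
Qed.

Lemma gold0B p q : gold0 (p - q) = gold0 p - gold0 q.
Proof. by rewrite /gold0 rmodpB ?monic_gold // coefB. Qed.

Lemma gold1B p q : gold1 (p - q) = gold1 p - gold1 q.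
Proof. by rewrite /gold1 rmodpB ?monic_gold // coefB. Qed.

Lemma cubicE (r : {poly int}) : (size r <= 4)%N ->
  r = (r`_0)%:P + (r`_1)%:P * 'X + (r`_2)%:P * 'X^2 + (r`_3)%:P * 'X^3.
Proof.
move=> r4; rewrite {1}(poly_size_leP r4) !big_ord_recr big_ord0 /=.
by rewrite expr0 mulr1 add0r.
Qed.

(** The constants come from X^2 = 3X - 1 and X^3 = 8X - 3 modulo [gold]; at 1, the double root of
    [quart] removes [h] from the value and the derivative. *)
Lemma quart_mod (h : {poly int}) (r0 r1 r2 r3 : int) :
  let b := h * quart + (r0%:P + r1%:P * 'X + r2%:P * 'X^2 + r3%:P * 'X^3) in
  [/\ gold0 b = r0 - r2 - 3 * r3, gold1 b = r1 + 3 * r2 + 8 * r3,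
      b.[1] = r0 + r1 + r2 + r3 & b^`().[1] = r1 + 2 * r2 + 3 * r3].
Proof.
move=> b.
have [] := @gold_rem_eq b
  (h * ('X - 1) ^+ 2 + r2%:P + r3%:P * ('X + 3)) (r0 - r2 - 3 * r3)
  (r1 + 3 * r2 + 8 * r3).
  by rewrite /b /quart /gold; ring.
move=> -> ->; split=> //.
  rewrite /b /quart expr2 !mulrA hornerD hornerM_X1.
  by rewrite !hornerE; ring.
rewrite /b /quart expr2 !mulrA derivD hornerD deriv_hornerM_X1 hornerM_X1 add0r.
by rewrite !derivE !hornerE /=; ring.
Qed.

(** * Diagonal coordinates and the isomorphism *)

Section Coordinates.
Variables (n : nat) (x y z t : int) (d1 d2 : nat).
Hypothesis n4 : (4 <= n)%N.
Hypotheses (d1_gt1 : (1 < d1)%N) (d2_gt1 : (1 < d2)%N).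
Hypothesis det1 : x * t - y * z = 1.
Hypothesis gold_cyc : forall a b : int,
  ideal2 gold (cyc n) (a%:P + b%:P * 'X) <->
  (d1 %| x * a + y * b)%Z /\ (d2 %| z * a + t * b)%Z.

Let n0 : (0 < n)%N. Proof. exact: leq_trans n4. Qed.

(** [form1] and [form2] are the rows of a unimodular change of basis of Z[X]/([gold]) that makes the
    ideal of X^n - 1 diagonal: the identity for n odd, the rows (1, 1) and (2, 3) for n even. *)
Definition form1 p : int := x * gold0 p + y * gold1 p.
Definition form2 p : int := z * gold0 p + t * gold1 p.

Lemma form1B p q : form1 (p - q) = form1 p - form1 q.
Proof. by rewrite /form1 gold0B gold1B; ring. Qed.

Lemma form2B p q : form2 (p - q) = form2 p - form2 q.
Proof. by rewrite /form2 gold0B gold1B; ring. Qed.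

Lemma form_scale (c : int) p :
  form1 (c%:P * p) = c * form1 p /\ form2 (c%:P * p) = c * form2 p.
Proof.
by rewrite /form1 /form2 /gold0 /gold1 mul_polyC rmodpZ ?monic_gold // !coefZ;
  split; ring.
Qed.

Lemma ideal2_gold_cycP p :
  ideal2 gold (cyc n) p <-> (d1 %| form1 p)%Z /\ (d2 %| form2 p)%Z.
Proof. by rewrite {1}(gold_remE p) ideal2_modl gold_cyc. Qed.

(** Once [p] is known to be divisible by 3, the criterion is that of [ideal2_quart] for p/3.
    Divisibility holds for the quotient by [quart] by assumption, and for the remainder because
    p(1), p'(1) and the two forms are unimodular coordinates on cubics. *)
Lemma ideal2_quart_cycP (p : {poly int}) : (size p <= n)%N ->
  ideal2 (3%:P * quart) (cyc n) p <->
  [/\ forall j, (j < n - 4)%N -> (3 %| (rdivp p quart)`_j)%Z,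
     p.[1] = 0, ((3 * n)%N %| p^`().[1])%Z,
     ((3 * d1)%N %| form1 p)%Z & ((3 * d2)%N %| form2 p)%Z].
Proof.
move=> pn; rewrite ideal2_scale_cyc //.
split=> [[q -> /(ideal2_quart _ n0)[/ideal2_gold_cycP[q1 q2]]]|].
  move=> /ideal2_sqr_cyc[q0 q']; have [-> ->] := form_scale 3 q.
  split.
  - by move=> j _; rewrite mul_polyC rdivpZ ?monic_quart // coefZ dvdz_mulr.
  - by rewrite mul_polyC hornerZ q0 mulr0.
  - by rewrite mul_polyC derivZ hornerZ PoszM dvdz_mul.
  - by rewrite PoszM dvdz_mul.
  - by rewrite PoszM dvdz_mul.
move=> [h3 p0 p' p1 p2].
have [q pq] : exists q, p = 3%:P * q.
  have [h hE] : exists h, rdivp p quart = 3%:P * h.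
    apply: poly_dvdzP => j; case: (ltnP j (n - 4)) => [/h3 //|jn].
    rewrite nth_default ?dvdz0 // (leq_trans (leq_size_rdivp _ monic_quart)) //.
    by rewrite size_quart (leq_trans _ jn) // leq_sub2r.
  have [r rE] : exists r, rmodp p quart = 3%:P * r.
    have r4 : (size (rmodp p quart) <= 4)%N.
      by rewrite -ltnS -size_quart ltn_rmodp monic_neq0 // monic_quart.
    have := quart_mod (rdivp p quart) (rmodp p quart)`_0 (rmodp p quart)`_1
      (rmodp p quart)`_2 (rmodp p quart)`_3.
    rewrite -(cubicE r4) -(rdivp_eq monic_quart) => -[e0 e1 eh ed].
    have : (3 %| form1 p)%Z by apply: dvdz_trans p1; rewrite PoszM dvdz_mulr.
    have : (3 %| form2 p)%Z by apply: dvdz_trans p2; rewrite PoszM dvdz_mulr.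
    have : (3 %| p^`().[1])%Z by apply: dvdz_trans p'; rewrite PoszM dvdz_mulr.
    (* Cramer's rule with determinant 1. *)
    have g0E : gold0 p = t * form1 p - y * form2 p.
      rewrite /form1 /form2 -[LHS]mul1r -det1; ring.
    have g1E : gold1 p = x * form2 p - z * form1 p.
      rewrite /form1 /form2 -[LHS]mul1r -det1; ring.
    move=> pd f2 f1.
    have g0 : (3 %| gold0 p)%Z by rewrite g0E rpredB // dvdz_mull.
    have g1 : (3 %| gold1 p)%Z by rewrite g1E rpredB // dvdz_mull.
    rewrite {}e0 {}e1 {}eh {}ed in g0 g1 pd p0.
    move: g0 g1 pd => /dvdzP[a ea] /dvdzP[b eb] /dvdzP[c ec].
    (* The system of [quart_mod] with p(1) = 0, solved over the integers. *)
    have r3E : (rmodp p quart)`_3 = (- a - c) * 3 by lia.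
    have r2E : (rmodp p quart)`_2 = (b + 5 * a + 4 * c) * 3 by lia.
    have r1E : (rmodp p quart)`_1 = (- 4 * c - 2 * b - 7 * a) * 3 by lia.
    have r0E : (rmodp p quart)`_0 = (b + 3 * a + c) * 3 by lia.
    apply: poly_dvdzP => -[|[|[|[|j]]]]; last 1 first.
    - by rewrite nth_default ?dvdz0 // (leq_trans r4).
    - by apply/dvdzP; exists (b + 3 * a + c); exact: r0E.
    - by apply/dvdzP; exists (- 4 * c - 2 * b - 7 * a); exact: r1E.
    - by apply/dvdzP; exists (b + 5 * a + 4 * c); exact: r2E.
    - by apply/dvdzP; exists (- a - c); exact: r3E.
  exists (h * quart + r).
  by rewrite {1}(rdivp_eq monic_quart p) hE rE; ring.
exists q => //; apply/ideal2_quart => //.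
move: p0 p' p1 p2; rewrite pq; have [-> ->] := form_scale 3 q.
rewrite mul_polyC derivZ !hornerZ !PoszM => q0 q'.
rewrite !dvdz_mul2l // in q' *.
move=> q1 q2; split; first exact/ideal2_gold_cycP.
apply/ideal2_sqr_cyc; by split=> //; lia.
Qed.

Lemma gold_forms_surj (a1 a2 : int) :
  exists p : {poly int}, [/\ (size p <= n)%N, form1 p = a1 & form2 p = a2].
Proof.
pose a := t * a1 - y * a2; pose b := x * a2 - z * a1.
exists (a%:P + b%:P * 'X).
have [] := @gold_rem_eq (a%:P + b%:P * 'X) 0 a b; first by rewrite mul0r add0r.
rewrite /form1 /form2 => -> ->; split.
- rewrite addrC size_MXaddC; case: ifP => // _.
  by rewrite (leq_trans _ n4) // ltnS (leq_trans (size_polyC_leq1 _)).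
- by rewrite -[RHS]mul1r -det1 /a /b; ring.
- by rewrite -[RHS]mul1r -det1 /a /b; ring.
Qed.

Lemma quart_coord_surj (h : nat -> int) (k a1 a2 : int) :
  exists p : {poly int}, [/\ (size p <= n)%N,
    forall j, (j < n - 4)%N -> (rdivp p quart)`_j = h j &
    [/\ p.[1] = 0, p^`().[1] = k, form1 p = a1 & form2 p = a2]].
Proof.
pose a := t * a1 - y * a2; pose b := x * a2 - z * a1.
(* The same integral solution of the system of [quart_mod], now for prescribed values; the quotient
   [H] remains free. *)
pose r3 := - a - k; pose r2 := b + 5 * a + 4 * k.
pose r1 := k - 2 * r2 - 3 * r3; pose r0 := - (r1 + r2 + r3).
pose H := \poly_(j < n - 4) h j.
pose r : {poly int} := Poly [:: r0; r1; r2; r3].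
have rE : r = r0%:P + r1%:P * 'X + r2%:P * 'X^2 + r3%:P * 'X^3.
  by rewrite /r /= !cons_poly_def; ring.
have r4 : (size r <= 4)%N by rewrite (leq_trans (size_Poly _)).
exists (H * quart + r).
have HE : rdivp (H * quart + r) quart = H.
  by rewrite rdivp_addl_mul_small ?monic_quart // size_quart ltnS.
split.
- rewrite (leq_trans (size_polyD _ _)) // geq_max (leq_trans r4) // andbT.
  rewrite (leq_trans (size_polyMleq _ _)) // size_quart addnS /=.
  by rewrite (leq_trans (leq_add (size_poly _ _) (leqnn _))) // subnK.
- by move=> j jn; rewrite HE coef_poly jn.
have := quart_mod H r0 r1 r2 r3; rewrite /= -rE => -[e0 e1 -> ->].
rewrite /form1 /form2 e0 e1; split.
- by rewrite /r0; ring.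
- by rewrite /r1; ring.
- by rewrite -[RHS]mul1r -[X in _ = X * _]det1 /r0 /r1 /r2 /r3 /a /b; ring.
- by rewrite -[RHS]mul1r -[X in _ = X * _]det1 /r0 /r1 /r2 /r3 /a /b; ring.
Qed.

Local Notation L := (laplacian (@Ygraph n)).
Implicit Types u v : 'cV[int]_#|{: 'I_4 * 'I_n}|.

Let coord u : ('rV['Z_3]_(n - 4) * 'Z_(3 * n) * 'Z_d1 * 'Z_(3 * d1) * 'Z_d2
    * 'Z_(3 * d2))%type :=
  let p := reduced1 u in let q := rmodp (reduced2 u) (cyc n) in
  (\row_j ((rdivp q quart)`_j)%:~R, (q^`().[1])%:~R, (form1 p)%:~R,
   (form1 q)%:~R, (form2 p)%:~R, (form2 q)%:~R).

(** Detects the free summand Z of the cokernel; the value at 1 is unchanged by reduction modulo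
    [cyc n]. *)
Let free u : int := (rmodp (reduced2 u) (cyc n)).[1].

Lemma reduced1B u v : reduced1 (u - v) = reduced1 u - reduced1 v.
Proof. by rewrite /reduced1 !layerB; ring. Qed.

Lemma reduced2B u v : rmodp (reduced2 (u - v)) (cyc n)
  = rmodp (reduced2 u) (cyc n) - rmodp (reduced2 v) (cyc n).
Proof.
by rewrite -rmodpB ?monic_cyc //; congr rmodp; rewrite /reduced2 !layerB; ring.
Qed.

Lemma Jac_Ygraph_iso : group_iso (Jac (@Ygraph n))
  ('rV['Z_3]_(n - 4) * 'Z_(3 * n) * 'Z_d1 * 'Z_(3 * d1) * 'Z_d2
    * 'Z_(3 * d2))%type.
Proof.
have n2 : (2 < n)%N := ltnW n4.
have m1 d : (1 < d)%N -> (1 < 3 * d)%N by lia.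
apply: (@torsion_coker_iso _ _ L _ coord free).
- move=> u v; rewrite /coord reduced1B reduced2B rdivpB ?monic_quart //.
  rewrite derivB hornerD hornerN !form1B !form2B !rmorphB !pairB.
  congr (_, _, _, _, _, _).
  by apply/rowP => j; rewrite !mxE coefB rmorphB.
- by move=> u v; rewrite /free reduced2B hornerD hornerN.
- move=> u; rewrite (mximage_laplacianP n2) ideal2_gold_cycP.
  rewrite [reduced2 u](rdivp_eq (monic_cyc n0)) ideal2_modr.
  rewrite ideal2_quart_cycP; last first.
    by rewrite -ltnS -(size_cyc n0) ltn_rmodp monic_neq0 // monic_cyc.
  rewrite /coord /free; move: (reduced1 u) (rmodp _ _) => p q.
  split=> [[[p1 p2] [h q0 q' q1 q2]]|[]].
    split=> //; congr (_, _, _, _, _, _); last 5 first.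
    + by apply/Zp_intr_eq0 => //; rewrite m1 // (leq_trans _ n4).
    + exact/Zp_intr_eq0.
    + by apply/Zp_intr_eq0 => //; exact: m1.
    + exact/Zp_intr_eq0.
    + by apply/Zp_intr_eq0 => //; exact: m1.
    by apply/rowP => j; rewrite !mxE; apply/Zp_intr_eq0 => //; exact: h.
  case=> /rowP h /Zp_intr_eq0 q' /Zp_intr_eq0 p1 /Zp_intr_eq0 q1
    /Zp_intr_eq0 p2 /Zp_intr_eq0 q2 q0.
  split; first by split; [exact: p1|exact: p2].
  split=> //.
  + move=> j jn; have := h (Ordinal jn); rewrite !mxE => /Zp_intr_eq0; exact.
  + by apply: q'; rewrite m1 // (leq_trans _ n4).
  + exact/q1/m1.
  + exact/q2/m1.
- move=> [[[[[h k] a1] b1] a2] b2].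
  have [k' <-] := Zp_intr_surj k.
  have [a1' <-] := Zp_intr_surj a1; have [b1' <-] := Zp_intr_surj b1.
  have [a2' <-] := Zp_intr_surj a2; have [b2' <-] := Zp_intr_surj b2.
  have [h' hh'] := choice (fun j => Zp_intr_surj (h 0 j)).
  have [p [pn p1 p2]] := gold_forms_surj a1' a2'.
  (* The default 0 is never read, as only indices below n - 4 occur. *)
  have [q [qn qh [q0 q' q1 q2]]] := quart_coord_surj
    (fun j => if insub j is Some i then h' i else 0) k' b1' b2'.
  (* With layers 0 and 3 zero, [reduced1] is layer 2 and [reduced2] is the sum of layers 1 and 2. *)
  have [x'|u uE] := @layer_surj n
    (fun x' => if x' == 1 then q - p else if x' == 2 then p else 0).
    case: ifP => _; last by case: ifP => // _; rewrite size_poly0.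
    by rewrite (leq_trans (size_polyD _ _)) // geq_max size_polyN qn pn.
  have e1 : reduced1 u = p by rewrite /reduced1 !uE /= subr0.
  have e2 : reduced2 u = q by rewrite /reduced2 !uE /=; ring.
  have e3 : rmodp (reduced2 u) (cyc n) = q.
    by rewrite e2 rmodp_small // size_cyc // ltnS.
  exists u; last by rewrite /free e3.
  rewrite /coord e1 e3 p1 p2 q1 q2 q'; congr (_, _, _, _, _, _).
  apply/rowP => j; rewrite mxE qh // insubT //= => jn.
  by rewrite -hh'; congr ((h' _)%:~R); exact: val_inj.
- do 5![apply: bounded_prod; last exact: bounded_Zp].
  exact/bounded_rV/bounded_Zp.
Qed.

End Coordinates.

(** * The two parities *)

Lemma group_iso_trans_bij (A B C : zmodType) (f : B -> C) :
  zmod_morphism f -> bijective f -> group_iso A B -> group_iso A C.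
Proof.
move=> fB fb [g gb].
pose fA : {additive B -> C} := HB.pack f (GRing.isZmodMorphism.Build _ _ f fB).
exists (fA \o g); exact: bij_comp.
Qed.

Lemma fib_gt1 n : (2 < n)%N -> (1 < fib n)%N.
Proof.
case: n => [|[|[|n]]] // _.
by elim: n => // n IH; rewrite (leq_trans IH) // leq_addr.
Qed.

Lemma lucas_gt1 n : (1 < n)%N -> (1 < lucas n)%N.
Proof.
case: n => [|[|n]] // _.
by elim: n => // n IH; rewrite (leq_trans IH) // leq_addr.
Qed.

(* Every modulus d below is at least 2, so that 'Z_d is indeed Z/d. *)
Theorem theorem2 (n : nat) (hn : (4 <= n)%N) :
  (odd n ->
     group_iso (Jac (@Ygraph n))
       ('rV['Z_3]_(n - 4) * 'Z_(3 * n) * 'rV['Z_(lucas n)]_2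
          * 'rV['Z_(3 * lucas n)]_2)%type) /\
  (~~ odd n ->
     group_iso (Jac (@Ygraph n))
       ('rV['Z_3]_(n - 4) * 'Z_(3 * n) * 'Z_(fib n) * 'Z_(3 * fib n)
          * 'Z_(5 * fib n) * 'Z_(15 * fib n))%type).
Proof.
(* This sign turns the difference in [ideal2_gold_cyc] into the Lucas sum of [binet] for n odd and
   its Fibonacci difference for n even. *)
have y2E : ('X - 2) ^+ n = (-1) ^+ n * (2 - 'X) ^+ n :> {poly int}.
  by rewrite -exprMn; congr (_ ^+ n); ring.
have [[s sE] [t tE]] := binet n.
split=> n_odd.
  have L1 : (1 < lucas n)%N by rewrite lucas_gt1 // (leq_trans _ hn).
  have good (a b : int) : ideal2 gold (cyc n) (a%:P + b%:P * 'X) <->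
      (lucas n %| 1 * a + 0 * b)%Z /\ (lucas n %| 0 * a + 1 * b)%Z.
    rewrite !mul1r !mul0r addr0 add0r -ideal2_gold_nat.
    apply: (@ideal2_gold_cyc _ _ s).
    by rewrite y2E -signr_odd n_odd expr1 mulN1r opprK.
  have det1 : 1 * 1 - 0 * 0 = 1 :> int by [].
  have := Jac_Ygraph_iso hn L1 L1 det1 good.
  pose R2 (d : nat) (a b : 'Z_d) := \row_(j < 2) (if j == 0 then a else b).
  have R2B d (a b a' b' : 'Z_d) :
      R2 d (a - a') (b - b') = R2 d a b - R2 d a' b'.
    by apply/rowP => j; rewrite !mxE; case: ifP.
  have R2K d (v : 'rV['Z_d]_2) : R2 d (v 0 0) (v 0 1) = v.
    apply/rowP => -[[|[|//]] j]; rewrite mxE -val_eqE /=;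
    by congr (v 0 _); apply: val_inj.
  (* Here d1 = d2, and equal moduli are regrouped into row vectors of length 2. *)
  apply: (@group_iso_trans_bij _ _ _ (fun '(r, a, b, c, b', c') =>
      (r, a, R2 (lucas n) b b', R2 (3 * lucas n)%N c c'))).
    move=> [[[[[r a] b] c] b'] c'] [[[[[r1 a1] b1] c1] b1'] c1'] /=.
    by rewrite !R2B.
  exists (fun '(r, a, v, w) =>
      (r, a, (v : 'rV_2) 0 0, (w : 'rV_2) 0 0, v 0 1, w 0 1)).
    by move=> [[[[[r a] b] c] b'] c']; rewrite !mxE.
  by move=> [[[r a] v] w]; rewrite !R2K.
have F1 : (1 < fib n)%N by rewrite fib_gt1 // (leq_trans _ hn).
have F5 : (1 < 5 * fib n)%N by rewrite (leq_trans F1) // leq_pmull.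
have good (a b : int) : ideal2 gold (cyc n) (a%:P + b%:P * 'X) <->
    (fib n %| 1 * a + 1 * b)%Z /\ ((5 * fib n)%N %| 2 * a + 3 * b)%Z.
  rewrite !mul1r -ideal2_gold_sqrt5.
  apply: (@ideal2_gold_cyc _ _ t).
  by rewrite y2E -signr_odd (negPf n_odd) expr0 mul1r.
have det1 : 1 * 3 - 1 * 2 = 1 :> int by [].
have -> : (15 * fib n = 3 * (5 * fib n))%N by rewrite mulnA.
exact: Jac_Ygraph_iso hn F1 F5 det1 good.
Qed.
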